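(* A countably based topological space $X$ is quasi-Polish if and only if there is an admissible representation $\rho\colon\subseteq\omega^\omega\to X$ of $X$ such that $\mathrm{dom}(\rho)$ (with the subspace topology from $\omega^\omega$) is a Polish space.
   Context: $\omega^\omega$ carries the product (Baire space) topology. A partial function $f\colon\subseteq A\to B$ is continuous if preimages of open sets are open in $\mathrm{dom}(f)$ with its subspace topology. A partial continuous function $\rho\colon\subseteq\omega^\omega\to X$ is an admissible representation of $X$ if for every partial continuous $f\colon\subseteq\omega^\omega\to X$ there is a partial continuous $g\colon\subseteq\omega^\omega\to\omega^\omega$ with $f=\rho\circ g$. A quasi-metric on a set $X$ is a function $d\colon X\times X\to[0,\infty)$ with $x=y$ iff $d(x,y)=d(y,x)=0$ and $d(x,z)\le d(x,y)+d(y,z)$; it induces the topology generated by $B_d(x,\varepsilon)=\{y\mid d(x,y)<\varepsilon\}$; $\widehat d(x,y)=\max\{d(x,y),d(y,x)\}$. $(x_n)$ is Cauchy if for every $\varepsilon>0$ there is $n_0$ with $d(x_n,x_m)<\varepsilon$ for all $m\ge n\ge n_0$; $d$ is complete if every Cauchy sequence converges in the topology of $\widehat d$. A space is quasi-Polish if it is countably based and its topology is induced by a complete quasi-metric. *)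

(* Defs.v *)
From mathcomp Require Import all_boot all_classical.
From mathcomp Require Import topology.
From Stdlib Require Import Reals.

Set Implicit Arguments.
Unset Strict Implicit.
Unset Printing Implicit Defensive.

Local Open Scope classical_set_scope.
Local Open Scope R_scope.

(** Baire space omega^omega := nat -> nat, with the product topology of
    discrete copies of nat: U is open iff every point of U has a basic
    cylinder neighbourhood (determined by a finite initial segment) in U. *)
Definition baire := nat -> nat.

Definition baire_open (U : set baire) : Prop :=
  forall p, U p -> exists n : nat,
    forall q : baire, (forall i : nat, (i < n)%nat -> q i = p i) -> U q.

(** A partial function f :⊆ omega^omega -> B is given by its domain
    Dom : set baire and a total function on the subtype {p | Dom p}. *)
Definition pdom (Dom : set baire) := {p : baire | Dom p}.

Definition subspace_open (Dom : set baire) (V : set (pdom Dom)) : Prop :=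
  exists U, baire_open U /\ forall q : pdom Dom, V q <-> U (proj1_sig q).

Definition pcont (Dom : set baire) (B : Type) (opB : set B -> Prop)
  (f : pdom Dom -> B) : Prop :=
  forall V, opB V -> subspace_open (fun q => V (f q)).

(** rho :⊆ omega^omega -> X is an admissible representation of X:
    rho is continuous and every partial continuous f :⊆ omega^omega -> X
    factors as f = rho ∘ g (equality of partial functions, i.e. equal
    domains and equal values) with g :⊆ omega^omega -> omega^omega
    partial continuous. *)
Definition admissible (X : topologicalType) (D : set baire)
  (rho : pdom D -> X) : Prop :=
  pcont (@open X) rho /\
  forall (Df : set baire) (f : pdom Df -> X), pcont (@open X) f ->
    exists (Dg : set baire) (g : pdom Dg -> baire),
      pcont baire_open g /\
      (forall p, Df p <-> exists hg : Dg p, D (g (exist _ p hg))) /\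
      (forall p (hf : Df p) (hg : Dg p) (hd : D (g (exist _ p hg))),
          f (exist _ p hf) = rho (exist _ (g (exist _ p hg)) hd)).

Definition countably_based (T : Type) (op : set T -> Prop) : Prop :=
  exists B : set (set T), countable B /\ (forall b, B b -> op b) /\
    forall U, op U -> forall x, U x -> exists b, B b /\ b x /\ b `<=` U.

Definition is_quasi_metric (T : Type) (d : T -> T -> R) : Prop :=
  (forall x y, 0 <= d x y) /\
  (forall x y, x = y <-> (d x y = 0 /\ d y x = 0)) /\
  (forall x y z, d x z <= d x y + d y z).

Definition qball (T : Type) (d : T -> T -> R) (x : T) (e : R) : set T :=
  fun y => d x y < e.

(** Open sets of the topology generated by the balls B_d(x,eps)
    (the balls form a base, by the triangle inequality). *)
Definition qm_open (T : Type) (d : T -> T -> R) (U : set T) : Prop :=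
  forall x, U x -> exists y e, 0 < e /\ qball d y e x /\ qball d y e `<=` U.

Definition induces (T : Type) (d : T -> T -> R) (op : set T -> Prop) : Prop :=
  forall U, op U <-> qm_open d U.

Definition dhat (T : Type) (d : T -> T -> R) (x y : T) : R := Rmax (d x y) (d y x).

Definition qm_cauchy (T : Type) (d : T -> T -> R) (u : nat -> T) : Prop :=
  forall e, 0 < e -> exists n0 : nat, forall n m : nat,
    (n0 <= n)%nat -> (n <= m)%nat -> d (u n) (u m) < e.

Definition qm_complete (T : Type) (d : T -> T -> R) : Prop :=
  forall u, qm_cauchy d u -> exists x, forall e, 0 < e ->
    exists N : nat, forall n : nat, (N <= n)%nat -> dhat d x (u n) < e.

Definition quasi_Polish (X : topologicalType) : Prop :=
  countably_based (@open X) /\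
  exists d : X -> X -> R, is_quasi_metric d /\ induces d (@open X) /\ qm_complete d.

Definition is_metric (T : Type) (d : T -> T -> R) : Prop :=
  is_quasi_metric d /\ (forall x y, d x y = d y x).

Definition separable (T : Type) (op : set T -> Prop) : Prop :=
  exists S : set T, countable S /\
    forall U, op U -> (exists x, U x) -> exists s, S s /\ U s.

Definition polish (T : Type) (op : set T -> Prop) : Prop :=
  separable op /\
  exists d : T -> T -> R, is_metric d /\ induces d op /\ qm_complete d.

(* Main.v *)
Require Import Defs.
From mathcomp Require Import all_boot all_classical.
From mathcomp Require Import topology.
From Stdlib Require Import Reals Lra.

(** Let [b] enumerate a base of [X].

    From a complete quasi-metric [d], take as names of points the sequences [p]
    such that, for every [j], some ball of radius [r <= 2^-j] about a point of
    [b (p j.+1)] contains [b (p j.+1)], while the ball of radius [2 r] lies in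
    [b (p j)]. The centres form a Cauchy sequence, and the sets [b (p j)] are a
    neighbourhood base of its limit. The condition only relates consecutive values
    of [p], so the set of names is closed in Baire space, hence Polish; a name of
    [f p] is found continuously in [p] by searching for least suitable indices.

    Conversely, let [rho] be admissible on a Polish domain with complete metric
    [e]. A diagonal argument shows that [X] is T0. The standard representation (a
    name of [x] enumerates a neighbourhood base of [x]) factors as [rho \o G], and
    the images [E s] under [G] of the cylinders of words [s] satisfy
    [rho (E s) = b s], the intersection of the [b i] for [i] in [s]. Say that [t]
    refines [s] if it extends [s] and [E t] lies in a small ball the double of
    which [rho] maps into [b s]. Every [x] in [b s] has a refinement [t] of [s]
    with [x] in [b t]; let its rank at [s] be the least code of such a [t], and
    infinity if [x] is not in [b s]. Then [d x y = 2^-k], for the least code [k] of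
    a word at which the rank of [y] exceeds that of [x], is a quasi-metric for the
    topology of [X]. Along a Cauchy sequence every rank is eventually
    nonincreasing, hence constant; so the words [s] such that [b s] ultimately
    contains the sequence can be refined again and again, and completeness of [e]
    yields a limit in the domain of [rho]. *)

Set Implicit Arguments.
Unset Strict Implicit.
Unset Printing Implicit Defensive.

Local Open Scope classical_set_scope.
Local Open Scope R_scope.

(** * Distances given by the first failing preorder *)

(** The value 0 when nothing satisfies [P] makes the search total, so that [least_name] can recurse
    before its searches are known to succeed. *)
Definition least (P : nat -> Prop) : nat :=
  match pselect (exists k, `[< P k >]) with
  | left h => ex_minn h
  | right _ => 0%nat
  end.

Lemma leastP (P : nat -> Prop) (k : nat) :
  P k -> P (least P) /\ (least P <= k)%nat.
Proof.
move=> Pk; rewrite /least; case: pselect => [h|[]]; last by exists k; apply/asboolP.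
by case: ex_minnP => m /asboolP Pm min; split=> //; apply: min; apply/asboolP.
Qed.

Lemma least_ex (P : nat -> Prop) : (exists k, P k) -> P (least P).
Proof. by move=> [k /leastP[]]. Qed.

Lemma least_eq (P : nat -> Prop) (c : nat) :
  P c -> (forall k, (k < c)%nat -> ~ P k) -> least P = c.
Proof.
move=> Pc min; have [Pl lc] := leastP Pc.
by move: lc; rewrite leq_eqVlt => /orP[/eqP //|/min].
Qed.

Lemma eventually_all_lt (P : nat -> nat -> Prop) :
  (forall k, exists N, forall n, (N <= n)%nat -> P k n) ->
  forall K, exists N, forall n, (N <= n)%nat -> forall k, (k < K)%nat -> P k n.
Proof.
move=> h; elim=> [|K [N hN]]; first by exists 0%nat.
have [M hM] := h K; exists (maxn N M) => n; rewrite geq_max => /andP[Nn Mn] k.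
by rewrite ltnS leq_eqVlt => /orP[/eqP ->|]; [exact: hM|exact: hN].
Qed.

Definition hpow (n : nat) : R := (/ 2) ^ n.

Lemma hpow_gt0 (n : nat) : 0 < hpow n.
Proof. by apply: pow_lt; lra. Qed.

Lemma hpowS (n : nat) : hpow n.+1 = hpow n / 2.
Proof. by rewrite /hpow /=; lra. Qed.

Lemma hpow_le (n k : nat) : (n <= k)%nat -> hpow k <= hpow n.
Proof.
move=> /subnK <-; elim: (k - n)%nat => [|m IH]; first by rewrite add0n; lra.
by rewrite addSn hpowS; have := hpow_gt0 (m + n); lra.
Qed.

Lemma hpow_small (e : R) : 0 < e -> exists n, hpow n < e.
Proof.
move=> e0; have [|N hN] := pow_lt_1_zero (/ 2) _ e e0.
  by rewrite Rabs_pos_eq; lra.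
exists N; have := hN N (PeanoNat.Nat.le_refl N).
by rewrite Rabs_pos_eq //; apply/Rlt_le/hpow_gt0.
Qed.

(** Used twice: equality of [k]-th coordinates yields the usual metric of Baire space, and
    comparison of ranks yields the quasi-metric on [X]. *)
Definition fdist (T : Type) (Q : nat -> T -> T -> Prop) (x y : T) : R :=
  if pselect (exists k, ~ Q k x y) then hpow (least (fun k => ~ Q k x y)) else 0.

Lemma fdist_ge0 (T : Type) (Q : nat -> T -> T -> Prop) (x y : T) :
  0 <= fdist Q x y.
Proof.
by rewrite /fdist; case: pselect => ? /=; [apply/Rlt_le/hpow_gt0|lra].
Qed.

Lemma fdist_ge (T : Type) (Q : nat -> T -> T -> Prop) (x y : T) (k : nat) :
  ~ Q k x y -> hpow k <= fdist Q x y.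
Proof.
move=> nQ; rewrite /fdist; case: pselect => [?|[]]; last by exists k.
by apply: hpow_le; have [] := leastP (P := fun k => ~ Q k x y) nQ.
Qed.

Lemma fdist_cases (T : Type) (Q : nat -> T -> T -> Prop) (x y : T) :
  fdist Q x y = 0 \/ exists2 k, ~ Q k x y & fdist Q x y = hpow k.
Proof.
rewrite /fdist; case: pselect => [[k nQ]|?]; [right|by left].
have [nQl _] := leastP (P := fun k => ~ Q k x y) nQ.
by exists (least (fun k => ~ Q k x y)).
Qed.

Lemma fdist_lt (T : Type) (Q : nat -> T -> T -> Prop) (x y : T) (n : nat) :
  fdist Q x y < hpow n <-> forall k, (k <= n)%nat -> Q k x y.
Proof.
split=> [lt k kn|h].
  by apply: contrapT => nQ; have := fdist_ge nQ; have := hpow_le kn; lra.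
case: (fdist_cases Q x y) => [->|[k nQ ->]]; first exact: hpow_gt0.
have nk : (n < k)%nat by rewrite ltnNge; apply/negP => /h.
by have := hpow_le nk; rewrite hpowS; have := hpow_gt0 n; lra.
Qed.

(** By transitivity, an index failing between [x] and [z] already fails between [x] and [y] or
    between [y] and [z]. So one of the two distances is at least that from [x] to [z]. *)
Lemma fdist_quasi_metric (T : Type) (Q : nat -> T -> T -> Prop) :
  (forall k x, Q k x x) -> (forall k x y z, Q k x y -> Q k y z -> Q k x z) ->
  (forall x y, (forall k, Q k x y) -> (forall k, Q k y x) -> x = y) ->
  is_quasi_metric (fdist Q).
Proof.
move=> Qr Qt Qa; split; first exact: fdist_ge0.
have fdist0 x y : fdist Q x y = 0 <-> forall k, Q k x y.
  split=> [d0 k|h]; last by case: (fdist_cases Q x y) => [//|[k []]].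
  by apply: contrapT => nQ; have := fdist_ge nQ; have := hpow_gt0 k; lra.
split=> [x y|x y z].
  split=> [->|[/fdist0 xy /fdist0 yx]]; last exact: Qa.
  by split; apply/fdist0 => k; exact: Qr.
have := fdist_ge0 Q x y; have := fdist_ge0 Q y z.
case: (fdist_cases Q x z) => [->|[k nQ ->]]; first lra.
case: (pselect (Q k x y)) => [Qxy|nQxy]; last by have := fdist_ge nQxy; lra.
have nQyz : ~ Q k y z by move=> /(Qt _ _ _ _ Qxy).
by have := fdist_ge nQyz; lra.
Qed.

Lemma fdist_sym (T : Type) (Q : nat -> T -> T -> Prop) (x y : T) :
  (forall k x y, Q k x y -> Q k y x) -> fdist Q x y = fdist Q y x.
Proof.
move=> Qs; rewrite /fdist; suff -> : (fun k => ~ Q k x y) = (fun k => ~ Q k y x) by [].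
by apply/funext => k; apply/propext; split=> + /Qs; apply.
Qed.

Lemma fdist_open (T : Type) (Q : nat -> T -> T -> Prop) (U : set T) :
  is_quasi_metric (fdist Q) ->
  (qm_open (fdist Q) U <->
   forall x, U x -> exists n, forall y, (forall k, (k < n)%nat -> Q k x y) -> U y).
Proof.
move=> [_ [d0 dt]]; split=> [oU x /oU[y [e [e0 [xy sub]]]]|h x /h[n hn]].
  have [|n hn] := hpow_small (e := e - fdist Q y x); first by move: xy; rewrite /qball; lra.
  exists n.+1 => z hz; apply: sub; rewrite /qball.
  have /fdist_lt : forall k, (k <= n)%nat -> Q k x z by move=> k kn; apply: hz.
  by have := dt y x z; lra.
exists x, (hpow n); split; first exact: hpow_gt0.
split; first by rewrite /qball; have [-> _] := (d0 x x).1 erefl; exact: hpow_gt0.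
by move=> y /fdist_lt hy; apply: hn => k /ltnW; exact: hy.
Qed.

Lemma fdist_complete (T : Type) (Q : nat -> T -> T -> Prop) :
  (forall u : nat -> T,
    (forall k, exists n0, forall n m, (n0 <= n)%nat -> (n <= m)%nat -> Q k (u n) (u m)) ->
    exists x, forall k, exists N, forall n, (N <= n)%nat -> Q k x (u n) /\ Q k (u n) x) ->
  qm_complete (fdist Q).
Proof.
move=> h u cu; have [|x hx] := h u.
  move=> k; have [n0 hn0] := cu _ (hpow_gt0 k); exists n0 => n m n0n nm.
  by have /fdist_lt := hn0 n m n0n nm; apply.
exists x => e /hpow_small[n hn].
have [N hN] := eventually_all_lt hx n.+1; exists N => m Nm.
apply: Rlt_trans hn; apply: Rmax_lub_lt; apply/fdist_lt => k kn;
  by have [] := hN m Nm k kn.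
Qed.

Lemma quasi_metric_qball_open (T : Type) (d : T -> T -> R) (x : T) (e : R) :
  is_quasi_metric d -> qm_open d (qball d x e).
Proof.
move=> [_ [d0 dt]] y xy; exists y, (e - d x y); move: xy; rewrite /qball => xy.
split; first lra.
split; first by have [-> _] := (d0 y y).1 erefl; lra.
by move=> z; have := dt x y z; lra.
Qed.

Lemma quasi_metric_qball_center (T : Type) (d : T -> T -> R) (x : T) (e : R) :
  is_quasi_metric d -> 0 < e -> qball d x e x.
Proof. by move=> [_ [d0 _]] e0; rewrite /qball; have [-> _] := (d0 x x).1 erefl. Qed.

(* The balls generating the topology need not be centred at [x]. *)
Lemma quasi_metric_centred_ball (T : Type) (d : T -> T -> R) (U : set T) (x : T) :
  is_quasi_metric d -> qm_open d U -> U x -> exists2 e, 0 < e & qball d x e `<=` U.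
Proof.
move=> [_ [_ dt]] oU /oU[y [e [e0 [xy sub]]]]; exists (e - d y x).
  by move: xy; rewrite /qball; lra.
by move=> z; rewrite /qball => xz; apply: sub; rewrite /qball; have := dt y x z; lra.
Qed.

(** * Baire space and admissible representations *)

Definition agree (n : nat) (p q : baire) : Prop :=
  forall i, (i < n)%nat -> q i = p i.

Lemma agreeW (m n : nat) (p q : baire) : (m <= n)%nat -> agree n p q -> agree m p q.
Proof. by move=> mn h i im; apply: h; apply: leq_trans mn. Qed.

Lemma agree_sym (n : nat) (p q : baire) : agree n p q -> agree n q p.
Proof. by move=> h i /h ->. Qed.

Lemma agree_trans (n : nat) (p q r : baire) :
  agree n p q -> agree n q r -> agree n p r.
Proof. by move=> h h' i im; rewrite h' // h. Qed.

Lemma subspace_openP (D : set baire) (V : set (pdom D)) :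
  subspace_open V <->
  forall p, V p -> exists n, forall q, agree n (sval p) (sval q) -> V q.
Proof.
split=> [[U [oU VU]] p /VU/oU[n hn]|h].
  by exists n => q pq; apply/VU/hn.
(* The witness is the union of all cylinders about points of [D] whose trace on [D] lies in [V]. *)
exists (fun p => exists n (p' : pdom D), agree n (sval p') p /\
  forall q, agree n (sval p') (sval q) -> V q); split=> [p [n [p' [pp' hV]]]|q].
  exists n => q pq; exists n, p'; by split=> //; apply: (agree_trans pp').
split=> [Vq|[n [p' [pq]]]]; last exact.
by have [n hn] := h _ Vq; exists n, q.
Qed.

Lemma pdom_eq (D : set baire) (p q : pdom D) : sval p = sval q -> p = q.
Proof. by case: p q => [p hp] [q hq] /=; exact: eq_exist. Qed.

Lemma mkseq_agree (n : nat) (p q : baire) : mkseq p n = mkseq q n <-> agree n p q.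
Proof.
split=> [e i im|h]; last first.
  by apply/eq_in_map => i; rewrite mem_iota add0n => /h.
by rewrite -(nth_mkseq 0%nat q im) -e nth_mkseq.
Qed.

(** The map [g] may be defined beyond [Df], where its values miss [D]. Its restriction is a total
    map between the domains, with continuity expressed by a modulus on initial segments. *)
Lemma admissible_lift (X : topologicalType) (D : set baire) (rho : pdom D -> X)
    (Df : set baire) (f : pdom Df -> X) :
  admissible rho -> pcont (@open X) f ->
  exists G : pdom Df -> pdom D, (forall p, rho (G p) = f p) /\
    forall p n, exists m, forall q, agree m (sval p) (sval q) ->
      agree n (sval (G p)) (sval (G q)).
Proof.
move=> [_ adm] /adm[Dg [g [gc [dom eqf]]]].
have lift (p : pdom Df) : exists y : pdom D, exists hg : Dg (sval p),
    g (exist _ (sval p) hg) = sval y.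
  case: p => p hp; have [hg hd] := (dom p).1 hp.
  by exists (exist _ _ hd), hg.
have [G hG] := choice lift; exists G; split=> [[p hp]|p n].
  have [/= hg e] := hG (exist _ p hp).
  have hd : D (g (exist _ p hg)) by rewrite e; exact: proj2_sig.
  by rewrite (eqf p hp hg hd); congr rho; apply: pdom_eq.
have [hg e] := hG p.
have oU : baire_open (agree n (sval (G p))).
  by move=> q h; exists n => r /(agree_trans h).
have /subspace_openP/(_ (exist _ _ hg)) := gc _ oU.
case=> [|m hm]; first by rewrite e.
exists m => q pq; have [hq <-] := hG q; exact: (hm (exist _ _ hq)).
Qed.

Definition t0 (X : topologicalType) : Prop :=
  forall x y : X, (forall U, open U -> (U x <-> U y)) -> x = y.

(** The repetitions serve [forces], where the index of a set bounds the length of a cylinder: each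
    member of the base needs indices beyond any given modulus. *)
Lemma enumerate_base (X : topologicalType) : countably_based (@open X) ->
  exists b : nat -> set X, (forall n, open (b n)) /\
    (forall U x, open U -> U x -> exists n, b n x /\ b n `<=` U) /\
    forall n K, exists2 m, (K <= m)%nat & b m = b n.
Proof.
move=> [B [/countable_injP[f finj] [Bo Bb]]].
have b0P m : exists c : set X, open c /\ forall c', B c' -> f c' = m -> c = c'.
  have [[c [Bc fc]]|nc] := pselect (exists c, B c /\ f c = m).
    exists c; split=> [|c' Bc' fc']; first exact: Bo.
    by apply: finj; rewrite ?inE // fc fc'.
  exists setT; split=> [|c' Bc' fc']; first exact: openT.
  by case: nc; exists c'.
have [b0 hb0] := choice b0P.
(* [logn 2] takes every value infinitely often, so that the enumeration repeats
   each member of the base at arbitrarily large indices. *)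
have log m K : exists2 n, (K <= n)%nat & logn 2 n = m.
  exists (expn 2 m * K.*2.+1)%nat.
    have : (K.*2.+1 <= expn 2 m * K.*2.+1)%nat by rewrite leq_pmull // expn_gt0.
    by apply: leq_trans; apply: leqW; rewrite -addnn leq_addr.
  rewrite lognM ?expn_gt0 // pfactorK // lognE.
  by rewrite dvdn2 /= odd_double /= addn0.
exists (fun n => b0 (logn 2 n)); split=> [n|]; first by have [] := hb0 (logn 2 n).
split=> [U x oU Ux|n K]; last by have [m Km e] := log (logn 2 n) K; exists m; rewrite ?e.
have [c [Bc [cx cU]]] := Bb U oU x Ux.
have [n _ e] := log (f c) 0%nat; exists n; rewrite e.
by have [_ /(_ c Bc erefl) ->] := hb0 (f c).
Qed.

Lemma quasi_metric_t0 (X : topologicalType) (d : X -> X -> R) :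
  is_quasi_metric d -> induces d (@open X) -> t0 X.
Proof.
move=> qd ind x y xy; have [d0 [dE _]] := qd.
have dist0 u v : (forall U : set X, open U -> U u -> U v) -> d u v = 0.
  move=> uv; have := d0 u v; have [//|duv duv0] := Req_dec (d u v) 0.
  have ob : open (qball d u (d u v)) by apply/ind/quasi_metric_qball_open.
  have /(uv _ ob) : qball d u (d u v) u by apply: quasi_metric_qball_center => //; lra.
  by rewrite /qball; lra.
by apply/dE; split; apply: dist0 => U oU; case: (xy U oU).
Qed.

(** Each instance of [L] involves two coordinates, which are eventually constant along a Cauchy
    sequence; hence coordinatewise limits stay in the domain. *)
Lemma local_closed_polish (L : nat -> nat -> nat -> Prop) :
  polish (@subspace_open (fun p : baire => forall j, L j (p j.+1) (p j))).
Proof.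
set D : set baire := fun p => _.
pose Q k (p q : pdom D) : Prop := sval q k = sval p k.
have Qm : is_quasi_metric (fdist Q).
  apply: fdist_quasi_metric => [//|k x y z|x y xy _]; first by rewrite /Q => -> ->.
  by apply/pdom_eq/funext => k; rewrite [RHS]xy.
split; last first.
  exists (fdist Q); split; first by split=> // x y; apply: fdist_sym.
  split=> [U|]; first by rewrite fdist_open //; exact: subspace_openP.
  apply: fdist_complete => u cu.
  have ex k : exists v n0, forall n, (n0 <= n)%nat -> sval (u n) k = v.
    by have [n0 hn0] := cu k; exists (sval (u n0) k), n0 => n; exact: hn0.
  have [p hp] := choice ex.
  have Dp : D p.
    move=> j; have [n0 h0] := hp j; have [n1 h1] := hp j.+1.
    rewrite -(h0 (maxn n0 n1)) ?leq_maxl // -(h1 (maxn n0 n1)) ?leq_maxr //.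
    exact: (proj2_sig (u _) j).
  exists (exist _ p Dp) => k; have [N hN] := hp k; exists N => n /hN.
  by rewrite /Q /= => ->.
have [[p0 _]|nD] := pselect (exists p : pdom D, True); last first.
  by exists set0; split=> // U _ [x _]; case: nD; exists x.
(* A point from each cylinder meeting [D] gives a countable dense set; [p0] fills in for the other
   words. *)
have pick (s : seq nat) : exists p : pdom D,
    forall (q : pdom D) n, mkseq (sval q) n = s -> mkseq (sval p) n = s.
  have [[q [n e]]|ne] := pselect (exists (q : pdom D) n, mkseq (sval q) n = s).
    exists q => q' n' e'; suff <- : n = n' by [].
    by rewrite -(size_mkseq (sval q) n) e -e' size_mkseq.
  by exists p0 => q n e; case: ne; exists q, n.
have [h hh] := choice pick.
exists (range h); split; first by apply: sub_countable (card_image_le _ _) _; exact: countableP.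
move=> U /subspace_openP oU [x /[dup] Ux /oU[n hn]].
exists (h (mkseq (sval x) n)); split; first by exists (mkseq (sval x) n).
by apply: hn; apply/mkseq_agree; rewrite (hh _ x n).
Qed.

(** * A representation from a complete quasi-metric *)

(* The doubled radius keeps the limit of the centres, which is only in the closed
   ball of radius [e], inside [b n]. *)
Definition ball_link (X : Type) (d : X -> X -> R) (b : nat -> set X) (j m n : nat) : Prop :=
  exists z e, 0 < e /\ e <= hpow j /\ b m z /\
    b m `<=` qball d z e /\ qball d z (2 * e) `<=` b n.

Lemma ball_link_refine (X : topologicalType) (d : X -> X -> R) (b : nat -> set X)
    (j n : nat) (U : set X) (x : X) :
  is_quasi_metric d -> induces d (@open X) -> (forall n, open (b n)) ->
  (forall U x, open U -> U x -> exists n, b n x /\ b n `<=` U) ->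
  open U -> U x -> b n x -> exists m, b m x /\ b m `<=` U /\ ball_link d b j m n.
Proof.
move=> qd ind bo bb oU Ux bx.
have [e e0 he] := quasi_metric_centred_ball qd ((ind _).1 (bo n)) bx.
(* Halving [e] keeps the ball of doubled radius inside [b n]. *)
pose e' := Rmin (e / 2) (hpow j).
have e'0 : 0 < e' by apply: Rmin_pos; [lra|exact: hpow_gt0].
have ob : open (qball d x e') by apply/ind/quasi_metric_qball_open.
have [|m [mx mb]] := bb (U `&` qball d x e') x (openI oU ob).
  by split=> //; exact: quasi_metric_qball_center.
exists m; split=> //; split; first by move=> y /mb[].
exists x, e'; split=> //; split; first exact: Rmin_r.
split=> //; split=> [y /mb[] //|y]; rewrite /qball => xy; apply: he; rewrite /qball.
by have := Rmin_l (e / 2) (hpow j); rewrite -/e'; lra.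
Qed.

Lemma ball_link_limit (X : topologicalType) (d : X -> X -> R) (b : nat -> set X)
    (p : baire) :
  is_quasi_metric d -> induces d (@open X) -> qm_complete d ->
  (forall j, ball_link d b j (p j.+1) (p j)) ->
  exists x, (forall j, b (p j) x) /\
    forall U, open U -> U x -> exists j, b (p j) `<=` U.
Proof.
move=> qd ind cd Lp; have [d0 [_ dt]] := qd.
have [z hz] := choice Lp; have [e he] := choice hz.
have bS j : b (p j.+1) `<=` b (p j).
  move=> y; have [e0 [_ [_ [sub1 sub2]]]] := he j.
  by move=> /sub1; rewrite /qball => h; apply: sub2; rewrite /qball; lra.
have bW j k : (j <= k)%nat -> b (p k) `<=` b (p j).
  move=> /subnK <-; elim: (k - j)%nat => [|i IH] //.
  by rewrite addSn => y /bS/IH.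
have zj j k : (j <= k)%nat -> d (z j) (z k) < e j.
  move=> jk; have [_ [_ [_ [sub _]]]] := he j; apply: sub.
  by have [_ [_ [zk _]]] := he k; apply: bW zk.
have [x hx] : exists x, forall e, 0 < e -> exists N, forall n, (N <= n)%nat ->
    dhat d x (z n) < e.
  apply: cd => r /hpow_small[N hN]; exists N => n m Nn nm.
  by have := zj _ _ nm; have [_ [en _]] := he n; have := hpow_le Nn; lra.
exists x; split=> [j|U oU Ux].
  have [e0 [_ [_ [_ sub]]]] := he j; apply: sub; rewrite /qball.
  have [N hN] := hx _ e0; have := hN (maxn N j) (leq_maxl _ _).
  have := zj j (maxn N j) (leq_maxr _ _); have := dt (z j) (z (maxn N j)) x.
  by rewrite /dhat; have := Rmax_r (d x (z (maxn N j))) (d (z (maxn N j)) x); lra.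
have [r r0 hr] := quasi_metric_centred_ball qd ((ind _).1 oU) Ux.
have [n hn] := hpow_small (e := r / 2) ltac:(lra).
have [N hN] := hx (r / 2) ltac:(lra).
(* The set at the successor index lies in the ball of radius less than [r / 2] about the preceding
   centre, which is itself within [r / 2] of [x]. *)
exists (maxn N n).+1 => y.
have [_ [en [_ [sub _]]]] := he (maxn N n); move=> /sub; rewrite /qball => zy.
apply: hr; rewrite /qball; have := hN (maxn N n) (leq_maxl _ _).
have := hpow_le (leq_maxr N n); have := dt x (z (maxn N n)) y.
by rewrite /dhat; have := Rmax_l (d x (z (maxn N n))) (d (z (maxn N n)) x); lra.
Qed.

(* The sets [b c] containing the whole image of a cylinder of length [c] form a
   base at [f p]; bounding the cylinder by the index [c] makes the search for
   the least such [c] depend on finitely many values of [p]. *)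
Definition forces (X : Type) (b : nat -> set X) (Df : set baire) (f : pdom Df -> X)
  (p : pdom Df) (c : nat) : Prop :=
  forall q : pdom Df, agree c (sval p) (sval q) -> b c (f q).

(** The last clause makes the name a neighbourhood base: stage [j.+1] enters [b j] whenever [j] is
    forced. The guard is [forces] rather than membership of [f p], since it depends only on the
    first [j] values of [p]. *)
Fixpoint least_name (X : Type) (b : nat -> set X) (L : nat -> nat -> nat -> Prop)
    (Df : set baire) (f : pdom Df -> X) (p : pdom Df) (j : nat) : nat :=
  if j is j'.+1 then least (fun c => forces b f p c /\
    L j' c (least_name b L f p j') /\ (forces b f p j' -> b c `<=` b j'))
  else least (forces b f p).

Lemma forces_agree (X : Type) (b : nat -> set X) (Df : set baire) (f : pdom Df -> X)
    (p q : pdom Df) (c : nat) :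
  agree c (sval p) (sval q) -> forces b f p c -> forces b f q c.
Proof. by move=> pq h r qr; apply: h; exact: agree_trans qr. Qed.

(** The modulus bounds both [n] and the first [n] values of the name of [p]. Every candidate up to
    such a value is then judged alike for [p] and [q], so the least ones coincide, stage by
    stage. *)
Lemma least_name_agree (X : Type) (b : nat -> set X) (L : nat -> nat -> nat -> Prop)
    (Df : set baire) (f : pdom Df -> X) (p : pdom Df) :
  (exists c, forces b f p c) ->
  (forall j, exists c, forces b f p c /\
    L j c (least_name b L f p j) /\ (forces b f p j -> b c `<=` b j)) ->
  forall n, exists m, forall q : pdom Df, agree m (sval p) (sval q) ->
    agree n (least_name b L f p) (least_name b L f q).
Proof.
move=> ex0 exS n; set g := least_name b L f.
have [|m hm] := @eventually_all_lt (fun j m => (g p j <= m)%nat) _ n.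
  by move=> j; exists (g p j).
exists (maxn m n) => q pq j jn.
have {}pqn : agree n (sval p) (sval q) by exact: agreeW (leq_maxr _ _) pq.
have {}pq : agree m (sval p) (sval q) by exact: agreeW (leq_maxl _ _) pq.
have gj i : (i <= j)%nat -> agree (g p i) (sval p) (sval q).
  by move=> ij; apply: agreeW pq; apply: hm => //; apply: leq_ltn_trans jn.
elim: j jn gj => [|j IH] jn gj; have := gj _ (leqnn _).
  rewrite /g /= => pqc; have hl := least_ex ex0.
  apply: least_eq => [|k kl qk]; first exact: forces_agree hl.
  have pk : forces b f p k.
    by apply: forces_agree qk; apply/agree_sym/agreeW/pqc/ltnW.
  by have [_] := leastP pk; rewrite leqNgt kl.
rewrite /g /=; set P := fun c => _ /\ _; set P' := fun c => _ /\ _ => pqc.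
have eg : g q j = g p j by apply: IH => [|i ij]; [exact: ltnW|apply: gj; exact: leqW].
have pqj : agree j (sval p) (sval q) by exact: agreeW (ltnW (ltnW jn)) pqn.
have [hl1 [hl2 hl3]] : P (least P) := least_ex (exS j).
apply: least_eq => [|k kl [qk [Lk sk]]].
  split; first exact: forces_agree hl1.
  split; first by rewrite -/(g q j) eg.
  by move=> qj; apply: hl3; apply: forces_agree qj; exact: agree_sym.
have Pk : P k.
  split; first by apply: forces_agree qk; apply/agree_sym/agreeW/pqc/ltnW.
  split; first by rewrite -/(g p j) -eg.
  by move=> pj; apply: sk; apply: forces_agree pj.
by have [_] := leastP Pk; rewrite leqNgt kl.
Qed.

Lemma quasi_Polish_representation (X : topologicalType) :
  quasi_Polish X ->
  exists (D : set baire) (rho : pdom D -> X),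
    admissible rho /\ polish (@subspace_open D).
Proof.
move=> [/enumerate_base[b [bo [bb brep]]] [d [qd [ind cd]]]].
have X0 := quasi_metric_t0 qd ind.
set L := ball_link d b.
pose D : set baire := fun p => forall j, L j (p j.+1) (p j).
have [rho hrho] := choice (fun p : pdom D => ball_link_limit qd ind cd (proj2_sig p)).
have rho_uniq (p : pdom D) x : (forall j, b (sval p j) x) ->
    (forall U, open U -> U x -> exists j, b (sval p j) `<=` U) -> rho p = x.
  move=> bx nx; have [br nr] := hrho p; apply: X0 => U oU.
  by split=> [/(nr U oU)|/(nx U oU)] [j]; apply.
exists D, rho; split; last exact: local_closed_polish.
split=> [V oV|Df f fc].
  apply/subspace_openP => p Vp; have [_ /(_ V oV Vp)[j sub]] := hrho p.
  exists j.+1 => q pq; apply: sub; have [bq _] := hrho q.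
  by rewrite -(pq j).
have ex m p : b m (f p) -> exists c, forces b f p c /\ b c = b m.
  move=> bp; have /subspace_openP/(_ p bp)[K hK] := fc _ (bo m).
  have [c Kc e] := brep m K; exists c; split=> // q pq.
  by rewrite e; apply: hK; exact: agreeW pq.
have ex0 p : exists c, forces b f p c.
  have [m [bm _]] := bb setT (f p) openT I.
  by have [c []] := ex m p bm; exists c.
pose g p := least_name b L f p.
have exS' p j n : b n (f p) -> exists c, forces b f p c /\ L j c n /\
    (forces b f p j -> b c `<=` b j).
  move=> bn; pose U := if pselect (forces b f p j) then b j else setT.
  have oU : open U by rewrite /U; case: pselect => ? //=; exact: openT.
  have Up : U (f p) by rewrite /U; case: pselect => [fj|//] /=; exact: fj.
  have [m [bm [mU Lm]]] := ball_link_refine j qd ind bo bb oU Up bn.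
  have [c [fp e]] := ex m p bm; exists c; split=> //.
  split=> [|fj]; first by move: Lm; rewrite /L /ball_link e.
  by rewrite e; move: mU; rewrite /U; case: pselect.
have gb p j : b (g p j) (f p).
  elim: j => [|j IH]; first by have := least_ex (ex0 p); exact.
  by have [h _] := least_ex (exS' p j _ IH); exact: h.
have exS p j := exS' p j _ (gb p j).
have Dg p : D (g p).
  by move=> j; have [_ []] := least_ex (exS p j).
exists Df, g; split.
  move=> U oU; apply/subspace_openP => p /oU[n hn].
  have [m hm] := least_name_agree (ex0 p) (exS p) n.
  by exists m => q /hm; exact: hn.
split=> [p|p hf hg hd]; first by split=> [hf|[hg _]] //; exists hf.
rewrite (Prop_irrelevance hg hf) in hd *; symmetry; apply: rho_uniq => [j|U oU Ux].
  exact: gb.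
(* Some copy [b c] of [b m] is forced, so stage [c.+1] of the name lies inside it. *)
have [m [bm mU]] := bb U _ oU Ux.
have [c [fc' e]] := ex m _ bm; exists c.+1.
have [_ [_ h]] := least_ex (exS (exist _ p hf) c).
by move=> y /(h fc'); rewrite e => /mU.
Qed.

(** * A complete quasi-metric from a representation *)

(* If [x] and [y] had the same neighbourhoods, every map from Baire space to
   {x, y} would be continuous and hence of the form [rho \o G] with [G]
   continuous; coding the maps [G] by points of Baire space, a diagonal argument
   produces a map that is not of this form. *)
Lemma admissible_t0 (X : topologicalType) (D : set baire) (rho : pdom D -> X) :
  admissible rho -> t0 X.
Proof.
move=> adm x y xy; apply: contrapT => neq.
(* Here [a] codes a continuous map sending [p] to [h]: from a long enough prefix of [p] it returns
   [(h n).+1], the value 0 being reserved for no answer yet. *)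
pose dec (a p h : baire) := forall n, exists k,
  a (pickle (mkseq p k, n)) = (h n).+1.
(* The diagonal map: it differs at [p] from the value that the map coded by [p] would give there. *)
pose f (p : pdom setT) : X :=
  if pselect (exists h : pdom D, dec (sval p) (sval p) (sval h) /\ rho h = y)
  then x else y.
have fc : pcont (@open X) f.
  move=> V oV; apply/subspace_openP => p Vp; exists 0%nat => q _; move: Vp.
  by have [] := xy V oV; rewrite /f; do 2!case: pselect => ? /=.
have [G [Gf Gc]] := admissible_lift adm fc.
pose stable s n w :=
  forall q : pdom setT, mkseq (sval q) (size s) = s -> sval (G q) n = w.
have stable_uniq s n w w' : stable s n w -> stable s n w' -> w = w'.
  pose q : pdom setT := exist _ (nth 0%nat s) I => sw sw'.
  by rewrite -(sw q) ?mkseq_nth // -(sw' q) ?mkseq_nth.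
have [a ha] : exists a : baire, forall s n w,
    a (pickle (s, n)) = w.+1 <-> stable s n w.
  have ex c : exists v, forall s n w, c = pickle (s, n) -> (v = w.+1 <-> stable s n w).
    have [[s [n [w [ec sw]]]]|nex] := pselect (exists s n w, c = pickle (s, n) /\ stable s n w).
      exists w.+1 => s' n' w'; rewrite ec => /(pcan_inj pickleK)[<- <-].
      by split=> [[<-]|/(stable_uniq _ _ _ _ sw) ->].
    by exists 0%nat => s n w ec; split=> // sw; case: nex; exists s, n, w.
  have [a ha] := choice ex; exists a => s n w; exact: ha.
pose pa : pdom setT := exist _ a I.
have dec_code (h : pdom D) : dec a a (sval h) <-> h = G pa.
  split=> [dh|-> n].
    apply/pdom_eq/funext => n; have [k /ha sk] := dh n.
    by rewrite (sk pa) // size_mkseq.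
  have [m hm] := Gc pa n.+1; exists m; apply/ha => q.
  by rewrite size_mkseq => e; apply: (hm q) => //; apply/mkseq_agree.
have := Gf pa; rewrite /f; case: pselect => /= [[h [/dec_code -> ->]]|nex e].
  by move=> e; apply: neq.
by apply: nex; exists (G pa); split=> //; apply/dec_code.
Qed.

Definition basic (X : Type) (b : nat -> set X) (s : seq nat) : set X :=
  fun x => forall i, i \in s -> b i x.

Lemma basic_open (X : topologicalType) (b : nat -> set X) (s : seq nat) :
  (forall n, open (b n)) -> open (basic b s).
Proof.
move=> bo; elim: s => [|n s IH].
  by rewrite (_ : basic b _ = setT); [exact: openT|apply/seteqP; split].
rewrite (_ : basic b _ = b n `&` basic b s); first exact: openI.
apply/seteqP; split=> x => [h|[bn h] i]; last by rewrite inE => /orP[/eqP ->|/h].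
by split=> [|i si]; apply: h; rewrite inE ?eqxx // si orbT.
Qed.

Lemma basic_prefix (X : Type) (b : nat -> set X) (s t : seq nat) :
  prefix s t -> basic b t `<=` basic b s.
Proof. by move=> /prefixP[r ->] x h i si; apply: h; rewrite mem_cat si. Qed.

(** In the last clause [y] is chosen before [V]: a single preimage of [x] in [E s] is approached by
    sets [E t] for which [x] remains in [basic b t]. *)
Definition is_scheme (X Y : Type) (b : nat -> set X) (opY : set Y -> Prop)
    (rho : Y -> X) (E : seq nat -> set Y) : Prop :=
  (forall s y, E s y -> basic b s (rho y)) /\
  (forall s t, prefix s t -> E t `<=` E s) /\
  (forall s x, basic b s x -> exists y, rho y = x /\ E s y /\
    forall V, opY V -> V y -> exists t,
      prefix s t /\ (size s < size t)%nat /\ basic b t x /\ E t `<=` V).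

Lemma take_mkseq (p : baire) (m n : nat) : (m <= n)%nat -> take m (mkseq p n) = mkseq p m.
Proof. by move=> mn; rewrite /mkseq -map_take take_iota (minn_idPl mn). Qed.

Lemma admissible_scheme (X : topologicalType) (D : set baire) (rho : pdom D -> X)
    (b : nat -> set X) :
  admissible rho ->
  (forall U x, open U -> U x -> exists n, b n x /\ b n `<=` U) ->
  exists E, is_scheme b (@subspace_open D) rho E.
Proof.
move=> adm bb; have X0 := admissible_t0 adm.
pose names (p : baire) x := (forall i, b (p i) x) /\
  forall U, open U -> U x -> exists i, b (p i) `<=` U.
pose S : set baire := fun p => exists x, names p x.
have [delta hd] := choice (fun p : pdom S => proj2_sig p).
have deltac : pcont (@open X) delta.
  move=> V oV; apply/subspace_openP => p Vp; have [_ /(_ V oV Vp)[i sub]] := hd p.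
  exists i.+1 => q pq; apply: sub; have [h _] := hd q.
  by rewrite -(pq i).
have [G [Gd Gc]] := admissible_lift adm deltac.
exists (fun s y => exists q : pdom S, mkseq (sval q) (size s) = s /\ y = G q).
split=> [s y [q [e ->]] i|].
  by rewrite Gd -{1}e => /mapP[j _ ->]; have [h _] := hd q; exact: h.
split=> [s t /prefixP[r ->] y [q [e ->]]|s x bx].
  exists q; split=> //; rewrite -(take_mkseq _ (leq_addr (size r) _)).
  by rewrite -size_cat e take_size_cat.
have [n0 [bn0 _]] := bb setT x openT I.
(* A name of [x] that starts with [s] and then lists all indices of base sets around [x], with [n0]
   replacing the others. *)
pose p : baire := fun i => if (i < size s)%nat then nth 0%nat s i
  else if pselect (b (i - size s)%nat x) then (i - size s)%nat else n0.
have px : names p x.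
  split=> [i|U oU Ux]; rewrite /p.
    by case: ifP => [si|_]; [exact/bx/mem_nth|case: pselect].
  have [n [bn nU]] := bb U x oU Ux; exists (n + size s)%nat.
  by rewrite ltnNge leq_addl /= addnK; case: pselect.
have Sp : S p by exists x.
have ps : mkseq p (size s) = s.
  apply: (@eq_from_nth _ 0%nat); rewrite size_mkseq // => i si.
  by rewrite nth_mkseq // /p si.
pose q : pdom S := exist _ p Sp.
have rq : rho (G q) = x.
  rewrite Gd; have [br nr] := hd q; have [bx' nx] := px; apply: X0 => U oU.
  by split=> [/(nr U oU)|/(nx U oU)] [j]; apply.
exists (G q); split=> //; split=> [|V /subspace_openP oV Vq]; first by exists q.
have [n hn] := oV _ Vq; have [m hm] := Gc q n.
pose k := maxn m (size s).+1.
have sk : (size s < k)%nat by exact: leq_maxr.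
exists (mkseq p k); split; first by rewrite prefixE take_mkseq ?ps // ltnW.
rewrite size_mkseq; do 2!split=> //.
  by move=> i /mapP[j _ ->]; have [h _] := px; exact: h.
move=> _ [r [e ->]]; apply/hn/hm; apply: agreeW (leq_maxl m (size s).+1) _.
by apply/mkseq_agree; rewrite -[LHS]e.
Qed.

(** As in [ball_link], the doubled radius leaves room for limits of points. The strict growth of
    words makes the radii tend to 0 along iterated refinements. *)
Definition refines (X Y : Type) (b : nat -> set X) (e : Y -> Y -> R) (rho : Y -> X)
    (E : seq nat -> set Y) (t s : seq nat) : Prop :=
  prefix s t /\ (size s < size t)%nat /\ exists y r, 0 < r /\ r <= hpow (size s) /\
    (forall z, qball e y (2 * r) z -> basic b s (rho z)) /\ E t `<=` qball e y r.

Lemma refines_prefix (X Y : Type) (b : nat -> set X) (e : Y -> Y -> R) (rho : Y -> X)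
    (E : seq nat -> set Y) (t s s' : seq nat) :
  prefix s s' -> refines b e rho E t s' -> refines b e rho E t s.
Proof.
move=> ss' [s't [lt [y [r [r0 [rs [sub Et]]]]]]].
have les : (size s <= size s')%nat by apply: size_prefix.
split; first exact: prefix_trans s't.
split; first exact: leq_ltn_trans lt.
exists y, r; split=> //; split; first by have := hpow_le les; lra.
by split=> // z /sub; exact: basic_prefix.
Qed.

Lemma refines_ex (X : topologicalType) (Y : Type) (b : nat -> set X) (e : Y -> Y -> R)
    (rho : Y -> X) (E : seq nat -> set Y) (s : seq nat) (x : X) :
  (forall n, open (b n)) -> is_quasi_metric e ->
  (forall U, open U -> qm_open e (rho @^-1` U)) ->
  is_scheme b (qm_open e) rho E ->
  basic b s x -> exists t, refines b e rho E t s /\ basic b t x.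
Proof.
move=> bo qe rc [_ [_ Eo]] bx; have [y [yx [_ hy]]] := Eo s x bx.
have [|R R0 hR] := quasi_metric_centred_ball (x := y) qe (rc _ (basic_open s bo)).
  by rewrite /preimage /= yx.
pose r := Rmin (R / 2) (hpow (size s)).
have r0 : 0 < r by apply: Rmin_pos; [lra|exact: hpow_gt0].
have [t [st [lt [bt Et]]]] := hy (qball e y r) (@quasi_metric_qball_open _ e y r qe)
  (@quasi_metric_qball_center _ e y r qe r0).
exists t; do 3!split=> //; exists y, r; split=> //; split; first exact: Rmin_r.
split=> // z; rewrite /qball => yz; apply: hR; rewrite /qball.
by have := Rmin_l (R / 2) (hpow (size s)); rewrite -/r; lra.
Qed.

(* The rank of [x] at [s] is the least [c] with [witness b ref s c x], or infinity
   if there is none. *)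
Definition witness (X : Type) (b : nat -> set X) (ref : seq nat -> seq nat -> Prop)
    (s : seq nat) (c : nat) (x : X) : Prop :=
  exists t, pickle t = c /\ ref t s /\ basic b t x.

(* The rank of [y] is at most that of [x], at the word coded by [k]. *)
Definition rank_le (X : Type) (b : nat -> set X) (ref : seq nat -> seq nat -> Prop)
    (k : nat) (x y : X) : Prop :=
  forall s : seq nat, pickle s = k -> forall c, witness b ref s c x ->
    exists2 c', (c' <= c)%nat & witness b ref s c' y.

Lemma witness_basic (X : Type) (b : nat -> set X) (ref : seq nat -> seq nat -> Prop)
    (s : seq nat) (c : nat) (x : X) :
  (forall t s, ref t s -> prefix s t) -> witness b ref s c x -> basic b s x.
Proof. by move=> rp [t [_ [ts bt]]]; apply: basic_prefix (rp _ _ ts) _ bt. Qed.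

Lemma witness_ex (X : Type) (b : nat -> set X) (ref : seq nat -> seq nat -> Prop)
    (s : seq nat) (x : X) :
  (forall s x, basic b s x -> exists t, ref t s /\ basic b t x) ->
  basic b s x -> exists c, witness b ref s c x.
Proof. by move=> re /re[t ht]; exists (pickle t), t. Qed.

Lemma basic1 (X : Type) (b : nat -> set X) (n : nat) (x : X) :
  basic b [:: n] x <-> b n x.
Proof. by split=> [|bn i]; [apply; rewrite inE|rewrite inE => /eqP ->]. Qed.

(** A witness [t] for [x] is one for every point of the open set [basic b t], so balls are
    neighbourhoods. Conversely, a finite rank at the word [[:: n]] forces membership in [b n]. *)
Lemma rank_quasi_metric (X : topologicalType) (b : nat -> set X)
    (ref : seq nat -> seq nat -> Prop) :
  t0 X -> (forall n, open (b n)) ->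
  (forall U x, open U -> U x -> exists n, b n x /\ b n `<=` U) ->
  (forall t s, ref t s -> prefix s t) ->
  (forall s x, basic b s x -> exists t, ref t s /\ basic b t x) ->
  is_quasi_metric (fdist (rank_le b ref)) /\
  induces (fdist (rank_le b ref)) (@open X).
Proof.
move=> X0 bo bb rp re.
have rank_open (U : set X) x : open U -> U x ->
    exists k, forall y, rank_le b ref k x y -> U y.
  move=> oU Ux; have [n [/basic1 bn nU]] := bb U x oU Ux.
  exists (pickle [:: n]) => y h; have [c wc] := witness_ex re bn.
  by have [c' _ /(witness_basic rp)/basic1/nU] := h _ erefl c wc.
have qd : is_quasi_metric (fdist (rank_le b ref)).
  apply: fdist_quasi_metric => [k x s _ c|k x y z xy yz s sk c|x y xy yx].
  - by exists c.
  - move=> /(xy s sk)[c1 c1c /(yz s sk)[c2 c2c1 w2]].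
    by exists c2 => //; exact: leq_trans c1c.
  - apply: X0 => U oU; split=> [/(rank_open U _ oU)|/(rank_open U _ oU)] [k]; exact.
split=> // U; rewrite fdist_open //; split=> [oU x Ux|h].
  by have [k hk] := rank_open U x oU Ux; exists k.+1 => y hy; apply/hk/hy.
have rank_nbhs n x : exists V, open V /\ V x /\
    forall y, V y -> forall k, (k < n)%nat -> rank_le b ref k x y.
  elim: n => [|n [V [oV [Vx hV]]]]; first by exists setT; split; [exact: openT|].
  suff [V' [oV' [V'x hV']]] : exists V', open V' /\ V' x /\
      forall y, V' y -> rank_le b ref n x y.
    exists (V `&` V'); split; first exact: openI.
    split=> // y [Vy V'y] k; rewrite ltnS leq_eqVlt => /orP[/eqP ->|]; first exact: hV'.
    exact: hV.
  have [[s [sn ex]]|nex] := pselect (exists s : seq nat, pickle s = n /\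
      exists c, witness b ref s c x).
    have [t [tc [ts bt]]] := least_ex ex.
    exists (basic b t); split; first exact: basic_open.
    split=> // y ty s'; rewrite -sn => /(pcan_inj pickleK) -> c wc.
    exists (pickle t); last by exists t.
    by rewrite tc; have [] := @leastP (fun c => witness b ref s c x) c wc.
  exists setT; split; first exact: openT.
  by split=> // y _ s sn c wc; case: nex; exists s; split=> //; exists c.
rewrite openE => x /h[n hn]; have [V [oV [Vx hV]]] := rank_nbhs n x.
by change (nbhs x U); rewrite nbhsE; exists V => // y /hV; exact: hn.
Qed.

Definition ultimately (T : Type) (u : nat -> T) (A : set T) : Prop :=
  exists N, forall n, (N <= n)%nat -> A (u n).

(** From [n0] on, the ranks at [s] cannot increase, so the least finite value attained persists. If
    none is attained, the sequence stays outside [basic b s]. *)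
Lemma rank_cauchy (X : Type) (b : nat -> set X) (ref : seq nat -> seq nat -> Prop)
    (u : nat -> X) (s : seq nat) :
  (forall t s, ref t s -> prefix s t) ->
  (forall s x, basic b s x -> exists t, ref t s /\ basic b t x) ->
  (forall k, exists n0, forall n m, (n0 <= n)%nat -> (n <= m)%nat ->
    rank_le b ref k (u n) (u m)) ->
  ultimately u (fun x => ~ basic b s x) \/
  exists t, ref t s /\ ultimately u
    (fun x => basic b t x /\ forall c, witness b ref s c x -> (pickle t <= c)%nat).
Proof.
move=> rp re /(_ (pickle s))[n0 hn0].
pose P c := exists2 n, (n0 <= n)%nat & witness b ref s c (u n).
have [ex|nex] := pselect (exists c, P c); last first.
  by left; exists n0 => n nn /(witness_ex re)[c wc]; apply: nex; exists c, n.
right; have [n nn [t [tl [ts bt]]]] := least_ex ex.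
exists t; split=> //; exists n => m nm.
have lec c : witness b ref s c (u m) -> (pickle t <= c)%nat.
  move=> wc; have [|_] := @leastP P c; last by rewrite -tl.
  by exists m => //; exact: leq_trans nm.
split=> //; have [|c' c't w] := hn0 n m nn nm s erefl (pickle t); first by exists t.
have /eqP e : c' == pickle t by rewrite eqn_leq c't lec.
by have [t' [t'c [_ bt']]] := w; have /(pcan_inj pickleK) <- : pickle t' = pickle t by rewrite t'c.
Qed.

Lemma scheme_complete (X : topologicalType) (Y : Type) (b : nat -> set X)
    (e : Y -> Y -> R) (rho : Y -> X) (E : seq nat -> set Y) :
  (forall n, open (b n)) -> is_metric e -> qm_complete e ->
  (forall U, open U -> qm_open e (rho @^-1` U)) ->
  is_scheme b (qm_open e) rho E ->
  qm_complete (fdist (rank_le b (refines b e rho E))).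
Proof.
move=> bo [qe es] ce rc hE; have [Erho [Emono Eo]] := hE.
set ref := refines b e rho E.
have rp t s : ref t s -> prefix s t by case.
have re s x : basic b s x -> exists t, ref t s /\ basic b t x by exact: refines_ex.
have [_ [_ tri]] := qe.
apply: fdist_complete => u cu.
pose ev s := ultimately u (basic b s).
have ev_ref s : ev s -> exists t, ref t s /\ ultimately u
    (fun x => basic b t x /\ forall c, witness b ref s c x -> (pickle t <= c)%nat).
  move=> [N hN]; have [[M hM]|//] := rank_cauchy s rp re cu.
  by case: (hM (maxn N M) (leq_maxr _ _)); apply: hN; exact: leq_maxl.
(* If [b j] ultimately contains [u], then [j] is appended before refining, so that the chain of
   words collects all such indices. *)
have next (sj : seq nat * nat) : exists t, ev sj.1 -> ev t /\ ref t sj.1 /\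
    (ev [:: sj.2] -> sj.2 \in t).
  case: sj => s j /=; have [es1|nes] := pselect (ev s); last by exists s.
  have [ej|nej] := pselect (ev [:: j]); last first.
    have [t [ts [N hN]]] := ev_ref s es1; exists t => _; split=> //.
    by exists N => n /hN[].
  have [t [ts [N hN]]] : exists t, ref t (rcons s j) /\ ultimately u
      (fun x => basic b t x /\ forall c, witness b ref (rcons s j) c x -> (pickle t <= c)%nat).
    apply: ev_ref; have [N hN] := es1; have [M hM] := ej; exists (maxn N M) => n.
    rewrite geq_max => /andP[/hN h1 /hM /basic1 h2] i.
    by rewrite mem_rcons inE => /orP[/eqP ->|/h1].
  exists t => _; split; first by exists N => n /hN[].
  split=> [|_]; first by apply: refines_prefix ts; exact: prefix_rcons.
  by have /prefixP[r ->] := rp _ _ ts; rewrite mem_cat mem_rcons inE eqxx.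
have [nx hnx] := choice next.
pose fix sg j := if j is j'.+1 then nx (sg j', j') else [::].
have evsg j : ev (sg j).
  by elim: j => [|j IH]; [exists 0%nat|have [] := hnx (sg j, j) IH].
have refsg j : ref (sg j.+1) (sg j) by have [_ []] := hnx (sg j, j) (evsg j).
have memsg j : ev [:: j] -> j \in sg j.+1 by have [_ []] := hnx (sg j, j) (evsg j).
have sizesg j : (j <= size (sg j))%nat.
  elim: j => // j IH; apply: leq_ltn_trans IH _; by have [_ []] := refsg j.
have Esg j k : (j <= k)%nat -> E (sg k) `<=` E (sg j).
  move=> /subnK <-; elim: (k - j)%nat => // i IH.
  by rewrite addSn => y /(Emono _ _ (rp _ _ (refsg _)))/IH.
have [y hy] := choice (fun j => proj2 (proj2 (refsg j))).
have [r hr] := choice hy.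
have rj j : r j <= hpow j.
  by have [_ [h _]] := hr j; have := hpow_le (sizesg j); lra.
have Esg_ex j : exists v, E (sg j) v.
  have [N /(_ N (leqnn _)) bN] := evsg j.
  by have [v [_ [Ev _]]] := Eo _ _ bN; exists v.
have [z hz] := choice Esg_ex.
have yz j k : (j < k)%nat -> e (y j) (z k) < r j.
  by move=> jk; have [_ [_ [_ sub]]] := hr j; apply: sub; apply: Esg jk _ _.
have [w hw] : exists w, forall e', 0 < e' -> exists N, forall n, (N <= n)%nat ->
    dhat e w (z n) < e'.
  apply: ce => a a0; have [j hj] := hpow_small (e := a / 2) ltac:(lra).
  exists j.+1 => n m jn nm.
  have := yz j n jn; have := yz j m (leq_trans jn nm).
  by have := tri (z n) (y j) (z m); rewrite (es (z n) (y j)); have := rj j; lra.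
have yw j : e (y j) w < 2 * r j.
  have [r0 _] := hr j; have [N hN] := hw _ r0.
  have := hN (maxn N j.+1) (leq_maxl _ _); rewrite /dhat.
  have := yz j (maxn N j.+1) (leq_maxr _ _).
  have := tri (y j) (z (maxn N j.+1)) w.
  have := Rmax_r (e w (z (maxn N j.+1))) (e (z (maxn N j.+1)) w); lra.
have basic_w s : basic b s (rho w) <-> ev s.
  split=> [bs|ev_s i si].
    have ob : qm_open e (rho @^-1` basic b s) by apply/rc/basic_open.
    have [a a0 ha] := quasi_metric_centred_ball qe ob bs.
    (* A third suffices: [w] is within [2 * r j] of [y j], and [v] within [r j]. *)
    have [j hj] := hpow_small (e := a / 3) ltac:(lra).
    have [N hN] := evsg j.+1; exists N => n /hN /Eo[v [<- [Ev _]]].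
    apply: ha; rewrite /qball; have [_ [_ [_ /(_ _ Ev)]]] := hr j.
    rewrite /qball; have := tri w (y j) v; rewrite (es w (y j)).
    by have := yw j; have := rj j; lra.
  (* The word [sg i.+1] contains [i], so [rho] maps its doubled ball into [b i]. *)
  have [_ [_ [sub _]]] := hr i.+1; apply: (sub w); first exact: yw.
  apply: memsg; have [N hN] := ev_s; exists N => n /hN h.
  by apply/basic1/h.
exists (rho w) => k.
have [[s sk]|nk] := pselect (exists s : seq nat, pickle s = k); last first.
  by exists 0%nat => n _; split=> s sk; case: nk; exists s.
(* Either the ranks at [s] are infinite both ultimately and at [rho w], or [t] is the least witness
   in both places: a witness for [rho w] is ultimately one for [u n]. *)
have [[N hN]|[t [ts [N hN]]]] := rank_cauchy s rp re cu.
  exists N => n Nn; split=> s'; rewrite -sk => /(pcan_inj pickleK) -> c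
    /(witness_basic rp); last by move=> /(hN n Nn).
  move=> /basic_w[M hM]; case: (hN (maxn N M) (leq_maxl _ _)); apply: hM.
  exact: leq_maxr.
have evt : ev t by exists N => n /hN[].
exists N => n Nn; split=> s'; rewrite -sk => /(pcan_inj pickleK) -> c wc.
  exists (pickle t); last by exists t; have [] := hN n Nn.
  have [t' [tc [ts' /basic_w[M hM]]]] := wc.
  have [_ h] := hN (maxn N M) (leq_maxl _ _); apply: h.
  by exists t'; do 2!split=> //; apply: hM; exact: leq_maxr.
exists (pickle t); last by exists t; do 2!split=> //; exact/basic_w.
by have [_ h] := hN n Nn; exact: h.
Qed.

Theorem theorem48 (X : topologicalType) :
  countably_based (@open X) ->
  (quasi_Polish X <->
   exists (D : set baire) (rho : pdom D -> X),
     admissible rho /\ polish (@subspace_open D)).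
Proof.
move=> cb; split=> [|[D [rho [adm [_ [e [me [ind ce]]]]]]]].
  exact: quasi_Polish_representation.
split=> //; have [b [bo [bb _]]] := enumerate_base cb.
have [E hE] := admissible_scheme adm bb.
have indE : @subspace_open D = qm_open e by apply/funext => U; apply/propext.
rewrite indE in hE.
have [qe _] := me.
have rc U : open U -> qm_open e (rho @^-1` U).
  by move=> /(proj1 adm); rewrite indE.
have rp t s : refines b e rho E t s -> prefix s t by case.
have re s x : basic b s x -> exists t, refines b e rho E t s /\ basic b t x.
  exact: refines_ex.
have [qd indd] := rank_quasi_metric (admissible_t0 adm) bo bb rp re.
exists (fdist (rank_le b (refines b e rho E))); split=> //; split=> //.
exact: scheme_complete.
Qed.
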